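(* A pseudo-type-$n$ vector field on $\mathbb{T}^2$ can have at most $2(n-1)$ invariant meridians and this bound is sharp. Any invariant meridian of a pseudo-type-$n$ vector field $\chi$ on $\mathbb{T}^2$ is a subset of $s(\chi)$.
   Context: Fix a real number $a>1$ and let $\mathbb{T}^2=\{(x,y,z)\in\mathbb{R}^3:(x^2+y^2-a^2)^2+z^2-1=0\}$. A triple $\chi=(P,Q,R)$ with $P,Q,R\in\mathbb{R}[x,y,z]$ denotes the polynomial vector field $P\frac{\partial}{\partial x}+Q\frac{\partial}{\partial y}+R\frac{\partial}{\partial z}$ in $\mathbb{R}^3$, acting on polynomials as a derivation. An algebraic surface $\{g=0\}$ is invariant for $\chi$ if $\chi g=Lg$ for some $L\in\mathbb{R}[x,y,z]$; $\chi$ is a vector field on $\mathbb{T}^2$ if $\{(x^2+y^2-a^2)^2+z^2-1=0\}$ is invariant in this sense. $\chi$ is a pseudo-type-$n$ vector field if $P,Q$ are homogeneous polynomials of degree $n$ (in particular nonzero) and $R=0$. $s(\chi)$ denotes the set of all singular points of $\chi$ (points where $P=Q=R=0$). A meridian plane is a plane $\{\lambda x+\mu y=0\}$ with $(\lambda,\mu)\in\mathbb{R}^2\setminus\{(0,0)\}$; it cuts $\mathbb{T}^2$ in two curves, called meridians. A meridian is invariant if its meridian plane is invariant for $\chi$. The multiplicity of an invariant meridian plane $\{\lambda x+\mu y=0\}$ is the largest $k$ such that $(\lambda x+\mu y)^k$ divides the extactic polynomial $\mathcal{E}_{\langle x,y\rangle}(\chi)=\begin{vmatrix}x&y\\ \chi(x)&\chi(y)\end{vmatrix}=xQ-yP$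 if this is nonzero, and infinite otherwise. Invariant meridians are counted with multiplicity: an invariant meridian plane of multiplicity $k$ contributes $2k$ meridians. Sharpness means that the bound is attained by some pseudo-type-$n$ vector field on $\mathbb{T}^2$. *)

(* Defs.v *)
(* MathComp-Analysis, with polynomials from multinomials. *)
From HB Require Import structures.
From mathcomp Require Import all_boot all_order all_algebra.
From mathcomp Require Import all_classical all_reals.
From mathcomp Require Import ereal topology normedtype esum.
From mathcomp Require mpoly.
(* Some notations of mpoly clash with those of MathComp-Analysis. *)
Import -(notations) mpoly.

Set Implicit Arguments.
Unset Strict Implicit.
Unset Printing Implicit Defensive.

Import Order.TTheory GRing.Theory Num.Theory.
Import numFieldNormedType.Exports.

Local Open Scope classical_set_scope.
Local Open Scope ring_scope.

Notation poly3 R := (mpoly 3 R).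
Notation space R := ('rV[R]_3).

Definition ix : 'I_3 := @Ordinal 3 0 isT.
Definition iy : 'I_3 := @Ordinal 3 1 isT.
Definition iz : 'I_3 := @Ordinal 3 2 isT.

Section Definitions.
Variable R : realType.

Definition pX : poly3 R := mpolyX R (mnm1 ix).
Definition pY : poly3 R := mpolyX R (mnm1 iy).
Definition pZ : poly3 R := mpolyX R (mnm1 iz).

Definition peval (g : poly3 R) (v : space R) : R := meval (v ord0) g.

Definition zeros (g : poly3 R) : set (space R) := [set v | peval g v = 0].

Record vector_field := VectorField
  { vfP : poly3 R; vfQ : poly3 R; vfR : poly3 R }.

Implicit Types (chi : vector_field) (g : poly3 R).

Definition vf_apply chi g : poly3 R :=
  vfP chi * mderiv ix g + vfQ chi * mderiv iy g + vfR chi * mderiv iz g.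

Definition invariant_surface chi g : Prop :=
  exists L : poly3 R, vf_apply chi g = L * g.

Definition torus_poly (a : R) : poly3 R :=
  (pX ^+ 2 + pY ^+ 2 - mpolyC 3 (a ^+ 2)) ^+ 2 + pZ ^+ 2 - 1.

Definition torus (a : R) : set (space R) := zeros (torus_poly a).

Definition vector_field_on_torus (a : R) chi : Prop :=
  invariant_surface chi (torus_poly a).

(* [ishomog1] holds of the zero polynomial in every degree. *)
Definition homogeneous (n : nat) g : Prop := g != 0 /\ g \is ishomog1 n mdeg.

Definition pseudo_type (n : nat) chi : Prop :=
  [/\ homogeneous n (vfP chi), homogeneous n (vfQ chi) & vfR chi = 0].

Definition singular_points chi : set (space R) :=
  [set v | [/\ peval (vfP chi) v = 0, peval (vfQ chi) v = 0
             & peval (vfR chi) v = 0]].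

Definition meridian_form g : Prop :=
  exists lam mu : R, (lam, mu) <> (0, 0) /\ g = lam *: pX + mu *: pY.

Definition extactic chi : poly3 R :=
  pX * vf_apply chi pY - pY * vf_apply chi pX.

Definition invariant_meridian_plane chi (H : set (space R)) : Prop :=
  exists g, [/\ meridian_form g, H = zeros g & invariant_surface chi g].

(* The form [g] cutting out the plane [H] is unique up to a nonzero scalar,
   so the supremum is the largest [k] such that [g ^+ k] divides the extactic
   polynomial, for any such [g]. *)
Definition plane_multiplicity chi (H : set (space R)) : \bar R :=
  if extactic chi == 0 then +oo%E
  else ereal_sup [set k%:R%:E | k in [set k : nat |
         exists g q, [/\ meridian_form g, H = zeros g
                       & extactic chi = q * g ^+ k]]].

(* Each plane counts for its two meridians; the sum is [+oo] if there are
   infinitely many invariant planes. *)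
Definition num_invariant_meridians chi : \bar R :=
  (\esum_(H in [set H | invariant_meridian_plane chi H])
     (2%:E * plane_multiplicity chi H))%E.

(* The two curves in which a meridian plane cuts the torus are the connected
   components of the intersection. *)
Definition meridian_of_plane (a : R) (H M : set (space R)) : Prop :=
  exists2 v, (torus a `&` H) v & M = connected_component (torus a `&` H) v.

Definition invariant_meridian (a : R) chi (M : set (space R)) : Prop :=
  exists2 H, invariant_meridian_plane chi H & meridian_of_plane a H M.

End Definitions.

(* Main.v *)
(* Invariance of the torus reads 4 (x^2 + y^2 - a^2) (x P + y Q) = L F with F
   the torus polynomial.  If the homogeneous polynomial x P + y Q of degree
   n + 1 is nonzero, then comparing lowest-degree parts (F has constant term
   a^4 - 1 != 0) shows that L has no terms of degree < n + 1, while comparing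
   top-degree parts gives deg L = n - 1.  Hence x P + y Q = 0, so that P = - y A
   and Q = x A with A of degree n - 1, and the extactic polynomial is
   (x^2 + y^2) A.  A linear form g in x, y cutting out an invariant plane is
   prime, is coprime to its rotation and to x^2 + y^2, and therefore divides A
   with the multiplicity of the plane; counting degrees gives the bound, and A,
   hence the field, vanishes on the plane.  The bound is attained by
   A = x^(n-1). *)

Require Import Defs.
From HB Require Import structures.
From mathcomp Require Import all_boot all_order all_algebra.
From mathcomp Require Import all_classical all_reals.
From mathcomp Require Import ereal topology normedtype esum.
From mathcomp Require Import ring zify.
From mathcomp Require mpoly.
Import -(notations) mpoly.

Set Implicit Arguments.
Unset Strict Implicit.
Unset Printing Implicit Defensive.

Import Order.TTheory GRing.Theory Num.Theory.

Local Open Scope classical_set_scope.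
Local Open Scope ring_scope.

(** * Structural induction on polynomials, and scaling of all variables by [t] *)

Lemma mpoly_ring_ind (A : comNzRingType) (k : nat) (P : mpoly k A -> Prop) :
    (forall c, P (mpolyC k c)) -> (forall i, P (mpolyX A (mnm1 i))) ->
    (forall p q, P p -> P q -> P (p + q)) ->
    (forall p q, P p -> P q -> P (p * q)) -> forall p, P p.
Proof.
move=> PC PX PD PM; elim/mpolyind => [|c m p _ _ Pp].
  by rewrite -(mpolyC0 k A).
apply: PD => //; rewrite -mul_mpolyC; apply: (PM) => //.
rewrite mpolyXE_id.
apply: (big_ind P) => [||i _]; [by rewrite -(mpolyC1 k A) | exact: PM |].
elim: (m i) => [|j Pj]; first by rewrite expr0 -(mpolyC1 k A).
by rewrite exprS; apply: PM.
Qed.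

(* [p(x_1, ..., x_k)] is sent to [p(t x_1, ..., t x_k)], a polynomial in [t]. *)
Definition scale_vars (A : comNzRingType) (k : nat) (p : mpoly k A) :
    {poly mpoly k A} :=
  mmap (polyC \o @mpolyC k A) (fun i => (mpolyX A (mnm1 i))%:P * 'X) p.

HB.instance Definition _ (A : comNzRingType) (k : nat) :=
  GRing.RMorphism.copy (@scale_vars A k)
    (mmap (polyC \o @mpolyC k A) (fun i => (mpolyX A (mnm1 i))%:P * 'X)).

Lemma scale_varsB (A : comNzRingType) (k : nat) :
  {morph @scale_vars A k : p q / p - q}.
Proof. exact: raddfB. Qed.

Lemma scale_varsD (A : comNzRingType) (k : nat) :
  {morph @scale_vars A k : p q / p + q}.
Proof. exact: raddfD. Qed.

Lemma scale_varsM (A : comNzRingType) (k : nat) :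
  {morph @scale_vars A k : p q / p * q}.
Proof. exact: rmorphM. Qed.

Lemma scale_varsC (A : comNzRingType) (k : nat) (c : A) :
  scale_vars (mpolyC k c) = (mpolyC k c)%:P.
Proof. by rewrite /scale_vars mmapC. Qed.

(** Each monomial of total degree [d] picks up exactly [d] factors [t]. *)
Lemma scale_vars_homog (A : comNzRingType) (k d : nat) (p : mpoly k A) :
  p \is ishomog1 d mdeg -> scale_vars p = p%:P * 'X^d.
Proof.
move=> hp; rewrite {2}(mpolyE p) rmorph_sum mulr_suml /scale_vars /mmap.
rewrite !big_seq; apply: eq_bigr => m mp /=.
rewrite -(dhomog_mf hp mp) -mul_mpolyC rmorphM /= -mulrA; congr (_ * _).
rewrite /mmap1 mpolyXE_id rmorph_prod mdegE -prodrXr -big_split /=.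
by apply: eq_bigr => i _; rewrite exprMn rmorphXn.
Qed.

(** * Comparison of orders and degrees in the scaling variable *)

(** The constant term of [r] is nonzero, so [q] must vanish at 0; one factor ['X] is cancelled at a
    time. *)
Lemma Xn_dvd_mulr (D : idomainType) (j : nat) (p q r : {poly D}) :
  r`_0 != 0 -> p * 'X^j = q * r -> exists q', q = q' * 'X^j.
Proof.
move=> r0; elim: j p q => [|j IH] p q E; first by exists q; rewrite expr0 mulr1.
have /eqP : (q * r)`_0 = 0 by rewrite -E exprSr mulrA coefMX.
rewrite coef0M mulf_eq0 (negPf r0) orbF => q0.
have /factor_theorem [q' Eq] : root q 0 by rewrite rootE horner_coef0.
rewrite subr0 in Eq.
have [|q'' E'] := IH p q'.
  apply: (mulIf (negbT (polyX_eq0 D))).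
  by rewrite -mulrA -exprSr E Eq; ring.
by exists q''; rewrite Eq E' exprSr mulrA.
Qed.

(* Comparing orders and degrees in [t]: the left side has order [d] and degree
   [d + 2], while the cofactor of [L] has order 0 and degree 4. *)
Lemma quartic_ndvd (D : idomainType) (d : nat) (r c w p : D) (L : {poly D}) :
  r != 0 -> c ^+ 2 - 1 != 0 ->
  (r%:P * 'X^2 - c%:P) * (p%:P * 'X^d) =
    L * ((r%:P * 'X^2 - c%:P) ^+ 2 + w%:P * 'X^2 - 1) -> p = 0.
Proof.
move=> r0 c0; set S := r%:P * 'X^2 - c%:P; set F := _ - 1 => E.
have F0 : F`_0 != 0.
  rewrite coefB coefD coefMXn expr2 coef0M coefB coefMXn /= coef1 /=.
  by rewrite coefC sub0r addr0 mulrNN -expr2.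
apply/eqP; apply: contraT => p0; move: E; rewrite mulrA => E.
have [q Eq] := Xn_dvd_mulr F0 E.
have {}E : S * p%:P = q * F.
  apply: (mulIf (_ : 'X^d != 0)); first by rewrite expf_neq0 ?polyX_eq0.
  by rewrite E Eq mulrAC.
have sS : size S = 3%N.
  rewrite size_polyDl size_Cmul // size_polyXn //.
  by rewrite size_polyN (leq_ltn_trans (size_polyC_leq1 _)).
have nS : S != 0 by rewrite -size_poly_gt0 sS.
have sF : size F = 5%N.
  have s2 : size (S ^+ 2) = 5%N by rewrite expr2 size_mul // sS.
  rewrite /F -addrA size_polyDl s2 //.
  rewrite (leq_ltn_trans (size_polyD _ _)) // gtn_max size_polyN size_poly1.
  rewrite andbT.
  rewrite (leq_ltn_trans (size_polyMleq _ _)) // size_polyXn addn3 /= !ltnS.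
  by rewrite (leq_trans (size_polyC_leq1 _)).
have np : p%:P != 0 by rewrite polyC_eq0.
have nF : F != 0 by rewrite -size_poly_gt0 sF.
have nq : q != 0.
  by apply: contraNneq (mulf_neq0 nS np) => q0; rewrite E q0 mul0r.
(* The left side now has degree 2, while a nonzero multiple of [F] has degree at least 4. *)
have := congr1 (size \o @polyseq _) E.
rewrite /= !size_mul // sS sF size_polyC p0.
move: nq; rewrite -size_poly_gt0; case: (size q) => // k _.
by rewrite [(k.+1 + _)%N]addnC.
Qed.

Lemma mderiv_var (A : comNzRingType) (k : nat) (i j : 'I_k) :
  mderiv i (mpolyX A (mnm1 j)) = (i == j)%:R.
Proof.
rewrite mderivX mnm1E eq_sym; case: eqP => [->|_]; last by rewrite scale0r.
rewrite scale1r -(mpolyX0 k A); congr (mpolyX A _).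
by apply/mnmP => t; rewrite mnmBE mnm0E subnn.
Qed.

(** * Tangency to the torus forces x P + y Q = 0 *)

Section TorusFields.
Variable R : realType.
Implicit Types (chi : vector_field R) (p q : poly3 R) (a l m : R).

Lemma vf_apply_pX chi : vf_apply chi (pX R) = vfP chi.
Proof. by rewrite /vf_apply !mderiv_var /=; ring. Qed.

Lemma vf_apply_pY chi : vf_apply chi (pY R) = vfQ chi.
Proof. by rewrite /vf_apply !mderiv_var /=; ring. Qed.

Lemma vf_apply_torus a chi : vfR chi = 0 ->
  vf_apply chi (torus_poly a) =
  4 * (pX R ^+ 2 + pY R ^+ 2 - mpolyC 3 (a ^+ 2))
    * (pX R * vfP chi + pY R * vfQ chi).
Proof.
move=> R0; rewrite /vf_apply R0 /torus_poly !expr2.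
rewrite -(mpolyC1 3 R) !(mderivD, mderivN, mderivM, mderivC, mderiv_var) /=.
by rewrite mpolyC1; ring.
Qed.

Lemma pX2Y2_neq0 : pX R ^+ 2 + pY R ^+ 2 != 0.
Proof.
apply/eqP => /(congr1 (meval (fun=> 1))).
rewrite rmorphD !rmorphXn /pX /pY /= !mevalXU rmorph0 /= expr1n => /eqP.
by rewrite (_ : 1 + 1 = 2%:R) // pnatr_eq0.
Qed.

(** Scaling the variables gives the identity of [quartic_ndvd] with r = x^2 + y^2, c = a^2 and w =
    z^2; there c^2 - 1 = a^4 - 1 is nonzero because a > 1. *)
Lemma torus_dvd_homog a (d : nat) p L : 1 < a -> p \is ishomog1 d mdeg ->
  (pX R ^+ 2 + pY R ^+ 2 - mpolyC 3 (a ^+ 2)) * p = L * torus_poly a -> p = 0.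
Proof.
move=> ha hp /(congr1 (@scale_vars R 3)).
have h2 i : mpolyX R (mnm1 i) ^+ 2 \is @ishomog1 3 R 2%N mdeg.
  by apply: (@dhomogMn _ _ _ 1%N); rewrite dhomogX /= mdeg1.
have sS : scale_vars (pX R ^+ 2 + pY R ^+ 2 - mpolyC 3 (a ^+ 2)) =
    (pX R ^+ 2 + pY R ^+ 2)%:P * 'X^2 - (mpolyC 3 (a ^+ 2))%:P.
  rewrite scale_varsB scale_varsC.
  by rewrite (@scale_vars_homog _ _ 2%N) //; apply: rpredD; apply: h2.
rewrite scale_varsM sS scale_varsM /torus_poly scale_varsB scale_varsD.
rewrite [(_ - _) ^+ 2]expr2 scale_varsM sS.
rewrite (scale_vars_homog hp) (scale_vars_homog (h2 iz)) -(mpolyC1 3 R).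
rewrite scale_varsC -expr2.
apply: (quartic_ndvd pX2Y2_neq0).
rewrite -rmorphXn -(mpolyC1 3 R) -rmorphB /= mpolyC_eq0.
by rewrite subr_eq0 gt_eqF // !exprn_egt1.
Qed.

Lemma tangent_eq0 a (n : nat) chi : 1 < a ->
  pseudo_type n chi -> vector_field_on_torus a chi ->
  pX R * vfP chi + pY R * vfQ chi = 0.
Proof.
move=> ha [[P0 hP] [Q0 hQ] R0] [L]; rewrite vf_apply_torus // => E.
(* The factor 4 from differentiating the square is moved into the cofactor. *)
apply: (@torus_dvd_homog a n.+1 _ (mpolyC 3 (4^-1) * L) ha).
  by apply: rpredD; apply: (@dhomogM _ _ _ 1%N); rewrite // dhomogX /= mdeg1.
have u4 : mpolyC 3 (4^-1 : R) * 4 = 1.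
  have -> : 4 = mpolyC 3 (4 : R) by rewrite rmorph_nat.
  by rewrite -rmorphM /= mulVf ?pnatr_eq0 // mpolyC1.
by rewrite -mulrA -E !mulrA u4 mul1r.
Qed.

(** * Linear forms in x and y, and their primality *)

Definition linform l m : poly3 R := l *: pX R + m *: pY R.

Lemma peval_linform l m (v : 'rV[R]_3) :
  peval (linform l m) v = l * v ord0 ix + m * v ord0 iy.
Proof. by rewrite /peval mevalD !mevalZ !mevalXU. Qed.

Lemma norm2_gt0 l m : (l, m) <> (0, 0) -> 0 < l ^+ 2 + m ^+ 2.
Proof.
move=> lm; rewrite lt_def addr_ge0 ?sqr_ge0 // andbT paddr_eq0 ?sqr_ge0 //.
rewrite !sqrf_eq0; apply/negP => /andP[/eqP l0 /eqP m0].
by apply: lm; rewrite l0 m0.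
Qed.

(** A point of the plane l x + m y = 0 off the z-axis. A polynomial that does not vanish there is
    not divisible by [linform l m], and a linear form in x, y that does vanish there is proportional
    to it. *)
Definition line_point l m : 'rV[R]_3 :=
  \row_(i < 3) (if i == ix then m else if i == iy then - l else 0).

Lemma line_pointE l m :
  (line_point l m ord0 ix = m) * (line_point l m ord0 iy = - l).
Proof. by rewrite !mxE. Qed.

(* Orthogonal projection onto the plane [linform l m = 0]; a polynomial is
   divisible by [linform l m] iff the projection kills it, so this form is
   prime. *)
Definition proj_plane l m : poly3 R -> poly3 R :=
  mmap (@mpolyC 3 R) (fun i => mpolyX R (mnm1 i) -
    mpolyC 3 ((if i == ix then l else if i == iy then m else 0)
              / (l ^+ 2 + m ^+ 2)) * linform l m).

Lemma proj_planeD l m : {morph proj_plane l m : p q / p + q}.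
Proof. exact: raddfD. Qed.

Lemma proj_planeM l m : {morph proj_plane l m : p q / p * q}.
Proof. exact: rmorphM. Qed.

Lemma proj_planeZ l m c p : proj_plane l m (c *: p) = c *: proj_plane l m p.
Proof. by rewrite /proj_plane mmapZ mul_mpolyC. Qed.

Lemma proj_planeX l m i : proj_plane l m (mpolyX R (mnm1 i)) =
  mpolyX R (mnm1 i) - ((if i == ix then l else if i == iy then m else 0)
                        / (l ^+ 2 + m ^+ 2)) *: linform l m.
Proof. by rewrite /proj_plane mmapX mmap1U mul_mpolyC. Qed.

Lemma proj_plane_linform l m : (l, m) <> (0, 0) ->
  proj_plane l m (linform l m) = 0.
Proof.
move=> lm; have n0 := lt0r_neq0 (norm2_gt0 lm).
rewrite {1}/linform proj_planeD !proj_planeZ !proj_planeX /=.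
rewrite !scalerBr !scalerA addrACA -opprD -scalerDl -/(linform l m).
by rewrite !mulrA -mulrDl -!expr2 divff // scale1r subrr.
Qed.

(** The projection moves each variable by a multiple of the form, and congruence modulo the form is
    stable under sums and products. *)
Lemma proj_plane_sub l m p : exists q, p - proj_plane l m p = q * linform l m.
Proof.
elim/mpoly_ring_ind: p => [c|i|p p' [q E] [q' E']|p p' [q E] [q' E']].
- by exists 0; rewrite /proj_plane mmapC subrr mul0r.
- by rewrite proj_planeX opprB addrC subrK -mul_mpolyC; eexists.
- by exists (q + q'); rewrite proj_planeD mulrDl -E -E'; ring.
- exists (q * p' + proj_plane l m p * q').
  by rewrite proj_planeM mulrDl mulrAC -E -mulrA -E'; ring.
Qed.

Lemma proj_plane_eq0 l m p :
  proj_plane l m p = 0 -> exists q, p = q * linform l m.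
Proof.
by move=> p0; case: (proj_plane_sub l m p) => q; rewrite p0 subr0; exists q.
Qed.

(** The projection is a ring morphism into a domain and kills the right side, so it kills [p] or
    [q]. The value of [p] at a point of the plane rules out [p]. *)
Lemma linform_prime l m p q r : (l, m) <> (0, 0) ->
  peval p (line_point l m) != 0 -> p * q = r * linform l m ->
  exists q', q = q' * linform l m.
Proof.
move=> lm p0 /(congr1 (proj_plane l m)).
rewrite !proj_planeM proj_plane_linform // mulr0.
move=> /eqP; rewrite mulf_eq0.
move=> /orP[/eqP/proj_plane_eq0 [s Ep]|/eqP/proj_plane_eq0 //].
move: p0; rewrite Ep {1}/peval mevalM -!/(peval _ _) peval_linform !line_pointE.
by rewrite (_ : l * m + m * - l = 0) ?mulr0 ?eqxx //; ring.
Qed.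

Lemma linform_neq0 l m : (l, m) <> (0, 0) -> linform l m != 0.
Proof.
move=> lm; apply/eqP => /(congr1 (fun p => peval p (line_point (- m) l))).
rewrite peval_linform !line_pointE opprK /peval meval0 -!expr2.
exact/eqP/lt0r_neq0/norm2_gt0.
Qed.

Lemma linform_Xn_prime l m k p q r : (l, m) <> (0, 0) ->
  peval p (line_point l m) != 0 -> p * q = r * linform l m ^+ k ->
  exists q', q = q' * linform l m ^+ k.
Proof.
move=> lm p0; elim: k q r => [|k IH] q r.
  by exists q; rewrite expr0 mulr1.
rewrite exprSr mulrA => E; have [q1 Eq] := linform_prime lm p0 E.
have [|q2 Eq1] := IH q1 r; last by exists q2; rewrite Eq Eq1 mulrA.
by apply: (mulIf (linform_neq0 lm)); rewrite -E Eq mulrA.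
Qed.

Lemma zeros_linform_eq l m l' m' : (l, m) <> (0, 0) -> (l', m') <> (0, 0) ->
  peval (linform l m) (line_point l' m') = 0 ->
  zeros (linform l m) = zeros (linform l' m').
Proof.
move=> lm lm'; rewrite peval_linform !line_pointE mulrN => /eqP.
rewrite subr_eq0 => /eqP E.
have key u s u' s' x y : (u, s) <> (0, 0) -> u * s' = s * u' ->
    u * x + s * y = 0 :> R -> u' * x + s' * y = 0.
  move=> /norm2_gt0/lt0r_neq0 n0 E1 E2; apply: (mulfI n0); rewrite mulr0.
  (* A Lagrange-type identity for (u^2 + s^2)(u' x + s' y), which avoids deciding which of [u], [s]
     is nonzero. *)
  transitivity ((u * u' + s * s') * (u * x + s * y)
                + (u * y - s * x) * (u * s' - s * u')); first by ring.
  by rewrite E2 E1 subrr !mulr0 addr0.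
apply/seteqP; split=> v; rewrite /zeros /= !peval_linform; apply: key => //.
by rewrite mulrC [RHS]mulrC E.
Qed.

(** * Degree counts; [msize] is the total degree plus one on nonzero polynomials *)

Lemma msize_mulS p q : p != 0 -> q != 0 ->
  (msize (p * q)).+1 = (msize p + msize q)%N.
Proof.
by move=> p0 q0; rewrite msizeM // prednK // ltn_addr // lt0n msize_poly_eq0.
Qed.

Lemma msize_linform l m : (l, m) <> (0, 0) -> (1 < msize (linform l m))%N.
Proof.
move=> lm; rewrite ltnNge; apply/negP => /msize1_polyC.
move: (mcoeff _ _) => c Ec; have c0 : c = 0.
  have := congr1 (fun p => peval p 0) Ec.
  rewrite peval_linform !mxE !mulr0 addr0.
  by rewrite /peval mevalC.
by move: (linform_neq0 lm); rewrite Ec c0 mpolyC0 eqxx.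
Qed.

Lemma msize_mul_linformXn l m k p : (l, m) <> (0, 0) -> p != 0 ->
  (msize p + k <= msize (p * linform l m ^+ k))%N.
Proof.
move=> lm p0; elim: k => [|k IH]; first by rewrite expr0 mulr1 addn0.
rewrite exprSr mulrA; have := msize_linform lm.
have := @msize_mulS (p * linform l m ^+ k) (linform l m).
rewrite linform_neq0 // mulf_neq0 ?expf_neq0 ?linform_neq0 // => /(_ isT isT).
by move: IH; lia.
Qed.

Lemma pY_linform : pY R = linform 0 1.
Proof. by rewrite /linform scale0r scale1r add0r. Qed.

Lemma pX_linform : pX R = linform 1 0.
Proof. by rewrite /linform scale0r scale1r addr0. Qed.

(** * Fields on the torus as multiples of the rotation field *)

(** In x P = - Q y the form y is prime and does not divide x, so it divides P; cancelling y then
    gives Q. *)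
Lemma tangent_rotation a (n : nat) chi : 1 < a ->
  pseudo_type n chi -> vector_field_on_torus a chi ->
  exists A, [/\ vfP chi = - (pY R * A), vfQ chi = pX R * A, A != 0
              & (msize A <= n)%N].
Proof.
move=> ha pt /(tangent_eq0 ha pt) E; have [[P0 hP] _ _] := pt.
have n01 : (0, 1) <> (0, 0) :> R * R by case=> /eqP; rewrite oner_eq0.
have [||B EB] := @linform_prime 0 1 (pX R) (vfP chi) (- vfQ chi) n01.
- by rewrite /peval mevalXU !mxE oner_neq0.
- by apply/eqP; rewrite -pY_linform mulNr [_ * pY R]mulrC -addr_eq0 E.
rewrite -pY_linform in EB.
have B0 : B != 0 by apply: contraNneq P0 => B0; rewrite EB B0 mul0r.
exists (- B); split; rewrite ?oppr_eq0 //.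
- by rewrite EB; ring.
- apply: (mulfI (_ : pY R != 0)); first by rewrite pY_linform linform_neq0.
  by apply/eqP; rewrite -subr_eq0 -E EB; apply/eqP; ring.
(* All monomials of P have degree [n]; dividing by y lowers the size by at least one. *)
have : (msize (vfP chi) <= n.+1)%N.
  rewrite msizeE big_seq; elim/big_ind: _ => // [x y|i iP].
    by rewrite geq_max => -> ->.
  by rewrite (dhomog_mf hP iP).
have := msize_mulS B0 (linform_neq0 n01); have := msize_linform n01.
by rewrite msizeN EB pY_linform; lia.
Qed.

(** * Invariant planes of A (- y d/dx + x d/dy) and their multiplicities *)

Section Rotation.
Variables (n : nat) (chi : vector_field R) (A : poly3 R).
Hypotheses (EP : vfP chi = - (pY R * A)) (EQ : vfQ chi = pX R * A).
Hypotheses (A0 : A != 0) (An : (msize A <= n)%N).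

Lemma extactic_rotation : extactic chi = (pX R ^+ 2 + pY R ^+ 2) * A.
Proof. by rewrite /extactic vf_apply_pX vf_apply_pY EP EQ; ring. Qed.

(** The field sends l x + m y to (m x - l y) A, and the rotated form takes the value l^2 + m^2 at
    [line_point l m]. *)
Lemma invariant_linform_dvd l m : (l, m) <> (0, 0) ->
  invariant_surface chi (linform l m) -> exists q, A = q * linform l m.
Proof.
move=> lm [L EL]; apply: (@linform_prime l m (linform m (- l)) A L) => //.
  rewrite peval_linform !line_pointE mulrNN -!expr2 addrC.
  by rewrite lt0r_neq0 ?norm2_gt0.
rewrite -EL /vf_apply /linform !mderivD !mderivZ !mderiv_var EP EQ /=.
by rewrite -!mul_mpolyC mpolyCN; ring.
Qed.

Lemma invariant_plane_singular H : vfR chi = 0 ->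
  invariant_meridian_plane chi H -> H `<=` singular_points chi.
Proof.
move=> R0 [_ [[l [m [lm ->]]] -> inv]] v /= gv.
have [q Eq] := invariant_linform_dvd lm inv.
have Av : peval A v = 0.
  by rewrite Eq /peval mevalM [meval _ (linform l m)]gv mulr0.
rewrite /singular_points /= EP EQ R0 /peval mevalN !mevalM -/(peval A v) Av.
by rewrite !mulr0 oppr0 meval0.
Qed.

(** Admissible exponents include 0 and are bounded by the size of the extactic polynomial, so a
    largest one exists. Its power of the form passes to [A], since x^2 + y^2 is nonzero at
    [line_point l m]. *)
Lemma plane_multiplicity_attained H : invariant_meridian_plane chi H ->
  exists k q l m, [/\ (l, m) <> (0, 0), H = zeros (linform l m),
    A = q * linform l m ^+ k & (plane_multiplicity chi H <= k%:R%:E)%E].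
Proof.
move=> [g0 [mg0 Hg0 _]].
have e0 : extactic chi != 0 by rewrite extactic_rotation mulf_neq0 ?pX2Y2_neq0.
pose K k := exists g q,
  [/\ meridian_form g, H = zeros g & extactic chi = q * g ^+ k].
have exK : exists k, `[< K k >].
  by exists 0%N; apply/asboolP; exists g0, (extactic chi); rewrite expr0 mulr1.
have ubK k : `[< K k >] -> (k <= msize (extactic chi))%N.
  move=> /asboolP [_ [q [[l [m [lm ->]]] _ E]]].
  have q0 : q != 0 by apply: contraNneq e0 => q0; rewrite E q0 mul0r.
  by have := msize_mul_linformXn k lm q0; rewrite -E; lia.
case: (ex_maxnP exK ubK) => k /asboolP [_ [q [[l [m [lm ->]]] HH E]]] kmax.
have [||q' EA] := @linform_Xn_prime l m k (pX R ^+ 2 + pY R ^+ 2) A q lm.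
- rewrite /peval mevalD !rmorphXn /= !mevalXU !line_pointE sqrrN addrC.
  by rewrite lt0r_neq0 ?norm2_gt0.
- by rewrite -extactic_rotation E.
exists k, q', l, m; split=> //.
rewrite /plane_multiplicity (negPf e0); apply: ge_ereal_sup => _ [j Kj <-].
by rewrite lee_fin ler_nat kmax //; apply/asboolP.
Qed.

Lemma plane_multiplicity_ge0 H : invariant_meridian_plane chi H ->
  (0 <= plane_multiplicity chi H)%E.
Proof.
move=> [g [mg Hg _]]; rewrite /plane_multiplicity; case: ifP => // _.
apply: ereal_sup_ubound; exists 0%N => //.
by exists g, (extactic chi); rewrite expr0 mulr1.
Qed.

(** [p] collects the powers of the forms of the planes in [s]. The last clause keeps the induction
    going: it makes [p] coprime to the form of any further plane. *)
Lemma sum_multiplicity_le (s : seq (set 'rV[R]_3)) : uniq s ->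
  {in s, forall H, invariant_meridian_plane chi H} ->
  exists p q, [/\ A = q * p,
    (\sum_(H <- s) 2%:E * plane_multiplicity chi H
       <= (2 * (msize p).-1)%N%:R%:E)%E
    & forall l m, (l, m) <> (0, 0) -> zeros (linform l m) \notin s ->
        peval p (line_point l m) != 0].
Proof.
elim: s => [|H s IH] /=.
  exists 1, A; split=> [||l m _ _]; rewrite ?mulr1 ?big_nil //.
  by rewrite /peval meval1 oner_neq0.
move=> /andP[Hs us] inv.
have [|p [q [Ep sp p0]]] := IH us.
  by move=> H' H's; apply: inv; rewrite inE H's orbT.
have [k [r [l [m [lm HH Er mk]]]]] :=
  plane_multiplicity_attained (inv H (mem_head _ _)).
have np : p != 0 by apply: contraNneq A0 => E; rewrite Ep E mulr0.
(* [H] is not in [s], so [p] is nonzero at its point and the new power must divide the cofactor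
   [q]. *)
have [||q' Eq] := @linform_Xn_prime l m k p q r lm.
- by apply: p0 => //; rewrite -HH.
- by rewrite mulrC -Ep.
exists (p * linform l m ^+ k), q'; split.
- by rewrite Ep Eq mulrAC mulrA.
- rewrite big_cons.
  apply: (@le_trans _ _ ((2 * k)%N%:R%:E + (2 * (msize p).-1)%N%:R%:E)%E).
    apply: leeD => //; by rewrite natrM EFinM lee_pmul2l.
  rewrite -EFinD lee_fin -natrD ler_nat.
  have := msize_mul_linformXn k lm np.
  have : (0 < msize p)%N by rewrite lt0n msize_poly_eq0.
  lia.
- move=> l' m' lm'; rewrite inE negb_or => /andP[nH ns].
  rewrite /peval mevalM rmorphXn mulf_neq0 ?p0 // expf_neq0 //.
  (* The new form vanishes at the point of another plane only if the two planes coincide. *)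
  by apply: contraNneq nH => E; rewrite HH (zeros_linform_eq lm lm' E).
Qed.

Lemma num_invariant_meridians_le :
  (num_invariant_meridians chi <= ((2 * (n - 1))%N)%:R%:E)%E.
Proof.
(* The sum is a supremum over finite sets [B] of invariant planes, so it suffices to bound each
   finite sum. *)
apply: ge_ereal_sup => _ [B [finB sB] <-]; rewrite fsbig_finite //=.
have [||p [q [Ep sp _]]] :=
  @sum_multiplicity_le (finmap.enum_fset (fset_set B)).
- exact: finmap.fset_uniq.
- by move=> H; rewrite in_fset_set // inE => /sB.
apply: (le_trans sp); rewrite lee_fin ler_nat leq_mul2l /=.
have /norP[q0 p0] : ~~ ((q == 0) || (p == 0)) by rewrite -mulf_eq0 -Ep.
move: An; rewrite Ep; have := msize_mulS q0 p0.
have : (0 < msize q)%N by rewrite lt0n msize_poly_eq0.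
lia.
Qed.

End Rotation.

(** * Sharpness of the bound *)

(** Positivity of [n] matters: for degree 0, [tangent_rotation] would give a nonzero [A] of size 0,
    so no such field exists. *)
Lemma meridian_bound_sharp a (n : nat) : 1 < a -> (0 < n)%N ->
  exists chi : vector_field R,
    [/\ pseudo_type n chi, vector_field_on_torus a chi
      & num_invariant_meridians chi = ((2 * (n - 1))%N)%:R%:E].
Proof.
(* From here [n] is the degree of the field minus one. *)
case: n => // n ha _; rewrite subn1 /=.
pose A := pX R ^+ n; pose chi := VectorField (- (pY R * A)) (pX R * A) 0.
have hX i : mpolyX R (mnm1 i) \is @ishomog1 3 R 1%N mdeg.
  by rewrite dhomogX /= mdeg1.
have x0 : pX R != 0.
  by rewrite pX_linform linform_neq0 // => -[/eqP]; rewrite oner_eq0.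
have y0 : pY R != 0.
  by rewrite pY_linform linform_neq0 // => -[/eqP]; rewrite oner_eq0.
have A0 : A != 0 by rewrite expf_neq0.
have hA : A \is @ishomog1 3 R n mdeg.
  by have := @dhomogMn _ _ _ 1%N _ n (hX ix); rewrite mul1n.
have pt : pseudo_type n.+1 chi.
  split=> //; split; rewrite ?oppr_eq0 ?mulf_neq0 //=.
    by rewrite rpredN; exact: (dhomogM (hX iy) hA).
  exact: (dhomogM (hX ix) hA).
have vt : vector_field_on_torus a chi.
  by exists 0; rewrite vf_apply_torus //= mul0r; ring.
exists chi; split=> //; apply/eqP; rewrite eq_le; apply/andP; split.
  have [A' [EP EQ A'0 A'n]] := tangent_rotation ha pt vt.
  by have := num_invariant_meridians_le EP EQ A'0 A'n; rewrite subn1.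
(* If A = 1 the bound is 0 and nonnegativity suffices. Otherwise the plane x = 0 is invariant and
   alone attains the bound, as A is a power of x. *)
case: n @A @chi {hA A0} pt vt => [|n] A chi pt vt.
  rewrite muln0; apply: esum_ge0 => H inv.
  by rewrite mule_ge0 //; apply: plane_multiplicity_ge0.
apply: esum_ge; exists [set zeros (pX R)].
  split; first exact: finite_set1.
  move=> _ ->; exists (pX R); split=> //; last first.
    by exists (- (pY R * pX R ^+ n)); rewrite vf_apply_pX /= /A exprSr; ring.
  by exists 1, 0; split; [case=> /eqP; rewrite oner_eq0 | exact: pX_linform].
rewrite fsbig_set1 natrM EFinM lee_pmul2l //.
rewrite /plane_multiplicity; case: ifP => [_|_]; first exact: leey.
apply: ereal_sup_ubound; exists n.+1 => //=.
exists (pX R), (pX R ^+ 2 + pY R ^+ 2).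
split=> //; last exact: extactic_rotation.
by exists 1, 0; split; [case=> /eqP; rewrite oner_eq0 | exact: pX_linform].
Qed.

End TorusFields.

Theorem proposition5p2 (R : realType) (a : R) (ha : 1 < a) (n : nat) :
  [/\ forall chi : vector_field R,
        pseudo_type n chi -> vector_field_on_torus a chi ->
        (num_invariant_meridians chi <= ((2 * (n - 1))%N)%:R%:E)%E,
      (0 < n)%N ->
        exists chi : vector_field R,
          [/\ pseudo_type n chi, vector_field_on_torus a chi
            & num_invariant_meridians chi = ((2 * (n - 1))%N)%:R%:E]
    & forall (chi : vector_field R) (M : set ('rV[R]_3)),
        pseudo_type n chi -> vector_field_on_torus a chi ->
        invariant_meridian a chi M -> M `<=` singular_points chi].
Proof.
split=> [chi pt vt||chi M pt vt [H inv [v _ ->]]].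
- have [A [EP EQ A0 An]] := tangent_rotation ha pt vt.
  exact: num_invariant_meridians_le EP EQ A0 An.
- exact: meridian_bound_sharp.
- have [A [EP EQ A0 _]] := tangent_rotation ha pt vt.
  have [_ _ R0] := pt.
  (* A meridian is a component of the torus cut by [H], hence lies in [H], where the field
     vanishes. *)
  apply: subset_trans (invariant_plane_singular EP EQ R0 inv).
  by move=> w /connected_component_sub [].
Qed.
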